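(* Let $p>1$, $q>0$ and let $\mu$ be a $p$-log-concave probability measure on $\mathbb{R}$ with a continuous strictly increasing cumulative distribution function $F$. Then there exist $c>0$ and $n_0\in\mathbb{N}$ such that for any $n\in\mathbb{N}$ with $n>n_0$ and any i.i.d. sample $(x_i)_{i=1}^n$ from $\mu$ with order statistics $(x_{(i)})_{i=1}^n$, with probability at least $1-c(\log n)^{-q}$, $$\sup_{1\le i\le n}|x_{(i)}-x_{(i)}^{*}|\le c\,\frac{\log\log n}{(\log n)^{1-1/p}},$$ where $x_{(i)}^{*}=F^{-1}(i/(n+1))$.
   Context: A probability measure $\mu$ on $\mathbb{R}$ is called $p$-log-concave, for $p\in(0,\infty)$, if it has a density function of the form $f(x)=a\exp(-g(x)^p)$, where $a>0$ is a constant and $g$ is non-negative and convex. The order statistics $x_{(1)}\le x_{(2)}\le\dots\le x_{(n)}$ are the sample values arranged in non-decreasing order. $F$ is strictly increasing on all of $\mathbb{R}$, and $F^{-1}:(0,1)\to\mathbb{R}$ is its inverse function. *)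

(* Defs.v *)
From HB Require Import structures.
From mathcomp Require Import all_boot all_order all_algebra.
From mathcomp Require Import all_classical all_reals all_analysis.
Import Order.TTheory GRing.Theory Num.Theory.
Import numFieldNormedType.Exports.

Set Implicit Arguments.
Unset Strict Implicit.
Unset Printing Implicit Defensive.

Local Open Scope classical_set_scope.
Local Open Scope ring_scope.

Definition p_log_concave (R : realType) (p : R)
    (mu : probability (measurableTypeR R) R) : Prop :=
  exists (a : R) (g : R -> R),
    [/\ 0 < a,
        forall x, 0 <= g x,
        convex_function (setT : set R^o) g &
        forall A : set (measurableTypeR R), measurable A ->
          mu A = (\int[lebesgue_measure]_(x in A)
                    (a * expR (- (g x `^ p)))%:E)%E].

(* The library's [cdf] is attached to a random variable and extended-real
   valued; this one is attached to a law on the line. *)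
Definition cdf_of (R : realType) (mu : probability (measurableTypeR R) R)
    (x : R) : R := fine (mu `]-oo, x]%classic).

(* Only meaningful on the range of an injective [F]: the inverse there, and the
   dummy value 0 elsewhere. *)
Definition inverse_fun (R : realType) (F : R -> R) : R -> R :=
  'pinv_(fun=> 0) setT F.

Definition mutually_independent d (T : measurableType d) (R : realType)
    (P : probability T R) (n : nat) (X : 'I_n -> {RV P >-> R}) : Prop :=
  forall (J : {set 'I_n}) (A : 'I_n -> set R),
    (forall i, measurable (A i)) ->
    P (\bigcap_(i in [set` J]) (X i @^-1` A i)) =
    (\prod_(i in J) P (X i @^-1` A i))%E.

Definition iid_sample d (T : measurableType d) (R : realType)
    (P : probability T R) (mu : probability (measurableTypeR R) R)
    (n : nat) (X : 'I_n -> {RV P >-> R}) : Prop :=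
  mutually_independent X /\
  forall (i : 'I_n) (A : set R), measurable A ->
    distribution P (X i) A = mu A.

(* 0-based: [order_stat x i] is the (i+1)-st smallest of the n values. *)
Definition order_stat (R : realType) (n : nat) (x : 'I_n -> R) (i : 'I_n) : R :=
  nth 0 (sort <=%R [seq x j | j <- enum 'I_n]) i.

(* Main.v *)
(* Write L = ln n, s = ln L / L^(1-1/p) and m = min(F, 1 - F).  Convexity of g
   makes both tails decay at a rate g^(p-1), by comparing the density with its
   translates; hence the quantiles at levels L^(-q)/n and L^(q+4)/n (and their
   mirror images) differ by O(s), and F (y + s) - F y >= c s m(y).  On the grid
   s Z between the quantiles at levels L^(q+4)/n and 1 - L^(q+4)/n, Chebyshev's
   inequality for the empirical count at y, with deviation of order n s m(y),
   fails with probability O(L^(-q-2)); the grid has O(L^2) points, so a union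
   bound costs O(L^(-q)).  Outside that range no sample point lies beyond the
   quantiles at levels L^(-q)/n and 1 - L^(-q)/n except with probability
   2 L^(-q), and everything in between is within O(s). *)

Require Import Defs.
From HB Require Import structures.
From mathcomp Require Import all_boot all_order all_algebra.
From mathcomp Require Import all_classical all_reals all_analysis.
From mathcomp Require Import measurable_realfun ring lra.
Import Order.TTheory GRing.Theory Num.Theory.
Import numFieldNormedType.Exports.

Local Open Scope classical_set_scope.
Local Open Scope ring_scope.

(** * Convex exponents and translates of the density *)

(** With [L = ln n], the factor [expR (- L)] in the levels is [1/n]. Chebyshev's bound at [y] is of
    order [n m / (n s m)^2 = 1 / (n m s^2)], which says nothing at the outermost order statistics,
    where [n m] stays bounded; hence the two levels at each end. Their ratio is a power of [L], with
    logarithm O(ln L). Where [F] is about [1/n] up to such powers, [g^p] is at least of order [L],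
    so the decay rate [g^(p-1) = (g^p)^(1-1/p)] is at least of order [L^(1-1/p)]; the quotient of
    the two is [s]. The exponent [q + 4] pays for two factors [L^2]: one from [1/s^2 <= L^2] in
    Chebyshev's bound, one from the number of grid points, since the grid covers a range O(L) with
    spacing at least [1/L]. As [g] is only convex, derivatives never appear: difference inequalities
    replace the slopes of [g] and the hazard rate of the law. *)

Lemma convex_function_three_points (R : realType) (g : R -> R) (x y z : R) :
  convex_function (setT : set R^o) g -> x <= y -> y <= z ->
  (z - x) * g y <= (z - y) * g x + (y - x) * g z.
Proof.
move=> cg xy yz.
have [xz|xz] := leP z x.
  have yz' : y = z by lra.
  have xz' : x = z by lra.
  by rewrite yz' xz' !subrr !mul0r addr0.
have zx : 0 < z - x by rewrite subr_gt0.
have t01 : Itv.spec (@Itv.num_sem R) (Itv.Real `[0%Z, 1%Z]) ((z - y) / (z - x)).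
  rewrite /= /Itv.num_sem/= in_itv/= num_real/=.
  by rewrite divr_ge0 ?(ltW zx)//= ?ler_pdivrMr// ?subr_ge0//; lra.
have := cg (Itv.mk t01) x z; rewrite !inE => /(_ Logic.I Logic.I).
rewrite !convRE/= /unstable.onem.
set t := (z - y) / (z - x).
have tE : (z - x) * t = z - y by rewrite /t mulrC divfK// gt_eqF.
have -> : conv (Itv.mk t01) (x : convex_lmodType R^o) z = y.
  rewrite -[LHS]/(t * x + (1 - t) * z).
  apply: (mulfI (lt0r_neq0 zx)); rewrite mulrDr mulrA tE.
  by rewrite mulrA mulrBr tE; ring.
move=> h; have {}h : g y <= t * g x + (1 - t) * g z :> R by [].
move: h; rewrite -(ler_pM2l zx) => /le_trans; apply.
have e1 : (z - x) * (t * g x) = (z - y) * g x by rewrite mulrA tE.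
have e2 : (z - x) * (t * g z) = (z - y) * g z by rewrite mulrA tE.
have e3 : (1 - t) * g z = g z - t * g z by rewrite mulrBl mul1r.
by rewrite e3 mulrDr mulrBr e1 e2; lra.
Qed.

Lemma convex_function_opp (R : realType) (g : R -> R) :
  convex_function (setT : set R^o) g ->
  convex_function (setT : set R^o) (g \o -%R).
Proof.
move=> cg t x y _ _ /=.
have := cg t (- x) (- y); rewrite !inE => /(_ Logic.I Logic.I).
have -> : conv t (- x : convex_lmodType R^o) (- y) = - conv t (x : convex_lmodType R^o) y :> R.
  rewrite -[LHS]/(t%:inum * - x + unstable.onem t%:inum * - y).
  by rewrite -[RHS]/(- (t%:inum * x + unstable.onem t%:inum * y)) opprD !mulrN.
by [].
Qed.

(** Strict sublevel sets of a convex function are intervals, and the rays []-oo, r[] generate the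
    Borel sets. *)
Lemma convex_function_measurable (R : realType) (g : R -> R) :
  convex_function (setT : set R^o) g -> measurable_fun [set: R] g.
Proof.
move=> cg; apply: (measurability _ (RGenInftyO.measurableE R)) => // _ [_ [r ->] <-].
rewrite setTI; apply: is_interval_measurable => x z /=.
rewrite !in_itv/= => gx gz y /andP[xy yz].
have := convex_function_three_points _ _ _ _ _ cg xy yz.
have [zx|xz] := leP z x; first by have <- : x = y by lra.
have zx : 0 < z - x by lra.
move=> h /=; rewrite in_itv/= -(ltr_pM2l zx); apply: (le_lt_trans h).
have : (z - y) * (r - g x) + (y - x) * (r - g z) > 0; last by lra.
have [?|xlty] := leP y x; first by (have -> : y = x by lra); nra.
by apply: ltr_wpDl; [apply: mulr_ge0|apply: mulr_gt0]; lra.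
Qed.

(** Slopes of a convex function increase; the slope over [[x, u]] is the intermediate term between
    those over [[x, y]] and [[u, v]]. *)
Lemma convex_function_left_slope (R : realType) (g : R -> R) (u v x y : R) :
  convex_function (setT : set R^o) g -> x <= y -> y <= u -> u < v ->
  (y - x) * (g u - g v) <= (v - u) * (g x - g y).
Proof.
move=> cg xy yu uv.
have [xley|xlty] := leP y x; first by (have -> : x = y by lra); rewrite !subrr mul0r mulr0.
have h1 := convex_function_three_points _ _ _ _ _ cg xy yu.
have h2 := convex_function_three_points _ _ _ _ _ cg (ltW (lt_le_trans xlty yu)) (ltW uv).
have xu : 0 < u - x by lra.
rewrite -(ler_pM2l xu).
have : (y - x) * ((u - x) * (g u - g v)) <= (y - x) * ((v - u) * (g x - g u)).
  by apply: ler_wpM2l; [lra|nra].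
suff : (y - x) * ((v - u) * (g x - g u)) <= (u - x) * ((v - u) * (g x - g y)) by lra.
have : (v - u) * ((y - x) * (g x - g u)) <= (v - u) * ((u - x) * (g x - g y)).
  by apply: ler_wpM2l; lra.
by lra.
Qed.

Lemma convex_function_left_growth (R : realType) (g : R -> R) (u v : R) :
  convex_function (setT : set R^o) g -> (forall x, 0 <= g x) ->
  u < v -> g v < g u ->
  exists (al x0 : R), [/\ 0 < al,
    forall x, x <= x0 -> 1 <= g x &
    forall x y, x <= y -> y <= x0 -> al * (y - x) <= g x - g y].
Proof.
move=> cg g0 uv gvu; pose al := (g u - g v) / (v - u).
have al0 : 0 < al by rewrite divr_gt0 ?subr_gt0.
have H x y : x <= y -> y <= u -> al * (y - x) <= g x - g y.
  move=> xy yu; have := convex_function_left_slope _ _ _ _ _ _ cg xy yu uv.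
  by rewrite /al mulrAC ler_pdivrMr ?subr_gt0//; lra.
have ai : 0 < al^-1 by rewrite invr_gt0.
(* Moving left from [u] by [al^-1] raises [g] by at least 1 above [g u >= 0]. The bound [1 <= g]
   later gives [1 <= g^(p-1)], hence plain exponential decay at rate [al]. *)
exists al, (u - al^-1); split => // [x xu|x y xy yu]; last by apply: H => //; lra.
have := H x u; rewrite lexx => /(_ _ isT); have := g0 u.
have : al * al^-1 <= al * (u - x) by rewrite ler_pM2l//; lra.
by rewrite divff ?gt_eqF// => a b /(_ ltac:(lra)); lra.
Qed.

(** By uniqueness of Lebesgue measure: its pushforward under a translation agrees with it on
    half-open intervals. The translation is packed as a measurable function so that the pushforward
    is a measure. *)
Lemma lebesgue_measure_translate (R : realType) (t : R) (A : set R) :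
  measurable A ->
  @lebesgue_measure R A = lebesgue_measure ((fun x => x + t) @^-1` A).
Proof.
have mt : measurable_fun [set: measurableTypeR R]
    ((fun x : R => x + t) : measurableTypeR R -> measurableTypeR R).
  by apply: measurable_funD => //; exact: measurable_cst.
move=> mA.
pose phi : {mfun measurableTypeR R >-> measurableTypeR R} :=
  HB.pack ((fun x : R => x + t) : measurableTypeR R -> measurableTypeR R)
    (isMeasurableFun.Build _ _ _ _ _ mt).
apply: (@lebesgue_measure_unique _ (pushforward lebesgue_measure phi)) => //.
move=> _ [[a b] _ <-]; rewrite /pushforward/=.
rewrite [X in _ = lebesgue_measure X](_ : _ = `]a - t, b - t]%classic); last first.
  by apply/seteqP; split => x /=; rewrite !in_itv/=; lra.
rewrite !lebesgue_measure_itv/= !lte_fin ltrD2r; case: ifP => // _.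
by rewrite -!EFinB; congr EFin; lra.
Qed.

Lemma ge0_integral_translate (R : realType) (t : R) (A : set R) (f : R -> \bar R) :
  measurable A -> measurable_fun [set: R] f -> (forall x, 0 <= f x)%E ->
  (\int[lebesgue_measure]_(x in A) f x =
   \int[lebesgue_measure]_(x in (fun x => (x + t)%R) @^-1` A) f (x + t)%R)%E.
Proof.
move=> mA mf f0.
have mt : measurable_fun [set: measurableTypeR R]
    ((fun x : R => x + t) : measurableTypeR R -> measurableTypeR R).
  by apply: measurable_funD => //; exact: measurable_cst.
have /= <- := @ge0_integral_pushforward _ _ _ _ _ _ mt lebesgue_measure A f.
- apply: eq_measure_integral => B mB _; exact: lebesgue_measure_translate.
- by [].
- exact: measurable_funTS.
- by move=> y _.
Qed.


Section density.
Context {R : realType} (p a : R) (g : R -> R) (mu : probability (measurableTypeR R) R).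
Hypotheses (a0 : 0 < a) (g0 : forall x, 0 <= g x) (mg : measurable_fun [set: R] g).
Hypothesis muE : forall A : set (measurableTypeR R), measurable A ->
  mu A = (\int[lebesgue_measure]_(x in A) (a * expR (- (g x `^ p)))%:E)%E.

Let density_measurable :
  measurable_fun [set: R] (fun x => (a * expR (- (g x `^ p)))%:E).
Proof.
apply/measurable_EFinP; apply: measurable_funM; first exact: measurable_cst.
apply: measurableT_comp => //; apply: measurableT_comp => //.
exact: (measurableT_comp (measurable_powR p)).
Qed.

Let density_ge0 x : (0 <= (a * expR (- (g x `^ p)))%:E)%E.
Proof. by rewrite lee_fin mulr_ge0 ?expR_ge0// ltW. Qed.

(** A change of variables turns both masses into integrals over [A], where the densities are
    compared pointwise. *)
Lemma translate_le (t K : R) (A : set R) : measurable A -> 0 <= K ->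
  (forall x, A x ->
    expR (- (g (x + t) `^ p)) <= K * expR (- (g x `^ p))) ->
  (mu [set x | A (x - t)%R] <= K%:E * mu A)%E.
Proof.
move=> mA K0 gK.
have mt : measurable_fun [set: R] (fun x : R => x - t).
  by apply: measurable_funB => //; exact: measurable_cst.
have mAt : measurable [set x | A (x - t)%R].
  by rewrite -[X in measurable X]setTI; exact: mt.
rewrite (muE _ mA) (muE _ mAt) (ge0_integral_translate _ t)//.
rewrite (_ : _ @^-1` _ = A); last first.
  by apply/seteqP; split => x /=; rewrite addrK.
rewrite -ge0_integralZl//; last exact: measurable_funTS.
apply: ge0_le_integral.
- exact: mA.
- by move=> x _; exact: density_ge0.
- apply: measurable_funTS.
  apply: (measurableT_comp density_measurable).
  by apply: measurable_funD => //; exact: measurable_cst.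
- by apply: measurable_funTS; exact: measurable_funeM.
- move=> x Ax; rewrite -EFinM lee_fin mulrCA ler_pM2l//.
  exact: gK.
Qed.

Lemma itv_mass_ge (x y G : R) : x <= y -> 0 <= p ->
  (forall u, x <= u <= y -> g u <= G) ->
  (((y - x) * (a * expR (- (G `^ p))))%:E <= mu `]x, y]%classic)%E.
Proof.
move=> xy p0 gG; rewrite muE//.
have -> : ((y - x) * (a * expR (- (G `^ p))))%:E =
   (\int[lebesgue_measure]_(u in `]x, y]) (cst (a * expR (- (G `^ p)))%:E u))%E.
  rewrite integral_cst//= lebesgue_measure_itv/= lte_fin.
  case: ifPn => [_|]; first by rewrite -EFinB -EFinM mulrC.
  by rewrite -leNgt => yx; (have -> : y = x by lra); rewrite subrr mul0r mule0.
apply: ge0_le_integral.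
- exact: measurable_itv.
- by move=> u _; rewrite lee_fin mulr_ge0 ?expR_ge0// ltW.
- exact: measurable_cst.
- exact: measurable_funTS.
- move=> u /=; rewrite in_itv/= => /andP[xu uy].
  have guG : g u <= G by apply: gG; rewrite (ltW xu).
  rewrite lee_fin ler_pM2l// ler_expR lerN2.
  by apply: ge0_ler_powR; rewrite ?nnegrE// (le_trans _ guG).
Qed.

End density.

(** * Tails of the distribution function *)

(** A tangent bound without the factor [p]: write [x^p = x^(p-1) x] and use monotonicity of the
    power [p - 1]. *)
Lemma powR_sub_ge (R : realType) (p x y : R) : 1 <= p -> 0 <= y -> y <= x ->
  y `^ (p - 1) * (x - y) <= x `^ p - y `^ p.
Proof.
move=> p1 y0 yx; have p0 : 0 < p by lra.
rewrite -(mulr_powRB1 y0 p0) -(mulr_powRB1 (le_trans y0 yx) p0).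
have : y `^ (p - 1) <= x `^ (p - 1).
  by apply: ge0_ler_powR; rewrite ?nnegrE; lra.
by move=> /(ler_wpM2l (le_trans y0 yx)); lra.
Qed.

Section cdf.
Context {R : realType} (mu : probability (measurableTypeR R) R).
Local Notation F := (cdf_of mu).

Lemma cdf_ofE x : mu `]-oo, x]%classic = (F x)%:E.
Proof. by rewrite /cdf_of fineK// fin_num_measure. Qed.

Lemma cdf_of_ge0 x : 0 <= F x.
Proof. by rewrite -lee_fin -cdf_ofE. Qed.

Lemma cdf_of_le1 x : F x <= 1.
Proof. by rewrite -lee_fin -cdf_ofE probability_le1. Qed.

Lemma cdf_of_itv x y : x <= y -> mu `]x, y]%classic = (F y - F x)%:E.
Proof.
move=> xy; have : mu `]-oo, y]%classic = (mu `]-oo, x]%classic + mu `]x, y]%classic)%E.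
  rewrite -measureU//; first by congr (mu _); rewrite -itv_bndbnd_setU// bnd_simp.
  by apply/seteqP; split => z //=; rewrite !in_itv/= => -[] ? /andP[]; lra.
rewrite !cdf_ofE EFinB => ->.
by rewrite addeAC subee ?add0e.
Qed.

Lemma cdf_of_homo : {homo F : x y / x <= y}.
Proof.
by move=> x y xy; rewrite -lee_fin -!cdf_ofE le_measure ?inE//; exact: subitvPr.
Qed.

Lemma cdf_of_setC x : mu `]x, +oo[%classic = (1 - F x)%:E.
Proof.
rewrite (_ : `]x, +oo[%classic = ~` `]-oo, x]%classic); last by rewrite setCitvl.
by rewrite probability_setC// EFinB; congr (_ - _)%E; exact: cdf_ofE.
Qed.

End cdf.

(* The two tails are treated at once: [H] is [F] or [fun x => 1 - F (- x)]. *)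
Definition tail_profile (R : realType) (p al a x0 : R) (H h : R -> R) : Prop :=
  [/\ forall x, x <= x0 -> 1 <= h x,
      forall x t, x <= x0 -> 0 <= t ->
        H (x - t) <= expR (- (al * t * h x `^ (p - 1))) * H x &
      forall x y, x <= y -> y <= x0 ->
        (y - x) * (a * expR (- (h x `^ p))) <= H y - H x].

Section tails.
Context {R : realType} (p a : R) (g : R -> R) (mu : probability (measurableTypeR R) R).
Hypotheses (p1 : 1 < p) (a0 : 0 < a) (g0 : forall x, 0 <= g x).
Hypothesis cg : convex_function (setT : set R^o) g.
Hypothesis muE : forall A : set (measurableTypeR R), measurable A ->
  mu A = (\int[lebesgue_measure]_(x in A) (a * expR (- (g x `^ p)))%:E)%E.
Local Notation F := (cdf_of mu).

Let mg : measurable_fun [set: R] g := convex_function_measurable _ _ cg.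

Lemma cdf_of_increment (x y G : R) : x <= y ->
  (forall u, x <= u <= y -> g u <= G) ->
  (y - x) * (a * expR (- (G `^ p))) <= F y - F x.
Proof.
move=> xy gG; rewrite -lee_fin -cdf_of_itv//.
by apply: (itv_mass_ge p a g mu) => //; apply: ltW; apply: lt_trans p1.
Qed.

Lemma density_bounded_itv (x y G : R) : x <= y ->
  (forall u, x <= u <= y -> g u <= G) -> y - x <= (a * expR (- (G `^ p)))^-1.
Proof.
move=> xy gG; rewrite -[leRHS]mul1r ler_pdivlMr ?mulr_gt0 ?expR_gt0//.
apply: le_trans (cdf_of_increment _ _ _ xy gG) _.
by have := cdf_of_le1 mu y; have := cdf_of_ge0 mu x; lra.
Qed.

(** A nondecreasing [g] would stay below [g 0] on the negative half-line, and an interval of length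
    [b + 1] there would carry mass above 1. *)
Lemma exists_decrease : exists u v, u < v /\ g v < g u.
Proof.
apply: contrapT => H.
have gm u v : u <= v -> g u <= g v.
  rewrite le_eqVlt => /predU1P[->//|uv]; rewrite leNgt; apply/negP => ?.
  by apply: H; exists u, v.
set b := (a * expR (- (g 0 `^ p)))^-1.
have b0 : 0 < b by rewrite invr_gt0 mulr_gt0 ?expR_gt0.
have := density_bounded_itv (- (b + 1)) 0 (g 0).
rewrite -/b => H1; suff : 0 - - (b + 1) <= b by lra.
by apply: H1 => [|u /andP[_ u0]]; [lra|exact: gm].
Qed.

Lemma exists_increase : exists u v, u < v /\ g u < g v.
Proof.
apply: contrapT => H.
have gm u v : u <= v -> g v <= g u.
  rewrite le_eqVlt => /predU1P[->//|uv]; rewrite leNgt; apply/negP => ?.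
  by apply: H; exists u, v.
set b := (a * expR (- (g 0 `^ p)))^-1.
have b0 : 0 < b by rewrite invr_gt0 mulr_gt0 ?expR_gt0.
have := density_bounded_itv 0 (b + 1) (g 0).
rewrite -/b => H1; suff : (b + 1) - 0 <= b by lra.
by apply: H1 => [|u /andP[u0 _]]; [lra|exact: gm].
Qed.

(** Shifting left by [t] raises [h] by at least [al * t], hence [h^p] by at least
    [al * t * h u^(p-1)]. Since [h x <= h u], the rate can be frozen at [x], which yields one factor
    valid on all of []-oo, x]]. *)
Lemma density_decay (h : R -> R) (al x0 x u t : R) : 0 < al ->
  (forall x, x <= x0 -> 1 <= h x) ->
  (forall x y, x <= y -> y <= x0 -> al * (y - x) <= h x - h y) ->
  u <= x -> x <= x0 -> 0 <= t ->
  expR (- (h (u - t) `^ p)) <=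
    expR (- (al * t * h x `^ (p - 1))) * expR (- (h u `^ p)).
Proof.
move=> al0 h1 hd ux xx0 t0.
rewrite -expRD ler_expR.
have hu : al * (u - (u - t)) <= h (u - t) - h u by apply: hd; lra.
have hux : al * (x - u) <= h u - h x by apply: hd; lra.
have hx1 := h1 _ xx0.
have alt : 0 <= al * t by rewrite mulr_ge0// ltW.
have alxu : 0 <= al * (x - u) by rewrite mulr_ge0 ?(ltW al0)//; lra.
have hu1 : h u <= h (u - t) by lra.
have hu0 : 0 <= h u by lra.
have := powR_sub_ge _ _ _ _ (ltW p1) hu0 hu1.
have : h x `^ (p - 1) <= h u `^ (p - 1).
  by apply: ge0_ler_powR; rewrite ?nnegrE ?subr_ge0 ?(ltW p1)//; lra.
move=> /(ler_wpM2l alt).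
have : h u `^ (p - 1) * (al * t) <= h u `^ (p - 1) * (h (u - t) - h u).
  by rewrite ler_wpM2l ?powR_ge0//; lra.
by lra.
Qed.

Lemma left_tail_profile : exists al x0, 0 < al /\ tail_profile R p al a x0 F g.
Proof.
have [u [v [uv gvu]]] := exists_decrease.
have [al [x0 [al0 h1 hd]]] := convex_function_left_growth _ _ _ _ cg g0 uv gvu.
exists al, x0; split => //; split => // [x t xx0 t0|x y xy yx0].
- rewrite -lee_fin EFinM -!cdf_ofE.
  have := translate_le p a g mu a0 mg muE (- t)
    (expR (- (al * t * g x `^ (p - 1)))) `]-oo, x]%classic.
  rewrite (_ : [set z | `]-oo, x]%classic (z - - t)] = `]-oo, (x - t)]%classic); last first.
    by apply/seteqP; split => z /=; rewrite !in_itv/=; lra.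
  apply; rewrite ?expR_ge0// => z; rewrite /= in_itv/= => zx; exact: (density_decay g al x0).
- apply: cdf_of_increment => // z /andP[xz zy].
  have := hd x z xz (le_trans zy yx0).
  by have : 0 <= al * (z - x) by [rewrite mulr_ge0 ?(ltW al0)//; lra]; lra.
Qed.

(** Reflection: [1 - F (- x)] is the mass of []- x, +oo[], and an increase of [g] is a decrease of
    [g \o -%R], which is again convex. *)
Lemma right_tail_profile : exists al x0, 0 < al /\
  tail_profile R p al a x0 (fun x => 1 - F (- x)) (g \o -%R).
Proof.
have [u [v [uv guv]]] := exists_increase.
have vu : - v < - u by lra.
have := convex_function_left_growth _ (g \o -%R) (- v) (- u)
  (convex_function_opp _ _ cg) (fun x => g0 (- x)) vu.
rewrite /= !opprK => /(_ guv)[al [x0 [al0 h1 hd]]].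
exists al, x0; split => //; split => // [x t xx0 t0|x y xy yx0].
- rewrite -lee_fin EFinM -!cdf_of_setC.
  have := translate_le p a g mu a0 mg muE t
    (expR (- (al * t * g (- x) `^ (p - 1)))) `]- x, +oo[%classic.
  rewrite (_ : [set z | `]- x, +oo[%classic (z - t)] = `]- (x - t), +oo[%classic); last first.
    by apply/seteqP; split => z /=; rewrite !in_itv/= !andbT; lra.
  apply; rewrite ?expR_ge0// => z; rewrite /= in_itv/= andbT => zx.
  have := density_decay (g \o -%R) al x0 x (- z) t al0 h1 hd.
  by rewrite /= opprD !opprK; apply => //; lra.
- have -> : 1 - F (- y) - (1 - F (- x)) = F (- x) - F (- y) by lra.
  have -> : y - x = - x - - y by lra.
  apply: cdf_of_increment; first lra.
  move=> z /andP[xz zy].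
  have := hd x (- z); rewrite /= !opprK => /(_ ltac:(lra) ltac:(lra)).
  by have : 0 <= al * (- z - x) by [rewrite mulr_ge0 ?(ltW al0)//; lra]; lra.
Qed.

End tails.

(** From [ln L = 2 ln (sqrt L) < 2 sqrt L], once [sqrt L] exceeds [2 A / e]. *)
Lemma near_pinfty_ln_le (R : realType) (A e : R) : 0 < e ->
  \forall L \near +oo, A * ln L <= e * L.
Proof.
move=> e0; near=> L.
have L1 : 1 <= L by near: L; exact: nbhs_pinfty_ge.
have L0 : 0 < L by lra.
have lnL0 : 0 <= ln L by exact: ln_ge0.
have [A0|A0] := leP A 0.
  by apply: (@le_trans _ _ 0); [rewrite mulr_le0_ge0|rewrite mulr_ge0// ltW].
have sL : 0 < Num.sqrt L by rewrite sqrtr_gt0.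
have LE : L = Num.sqrt L * Num.sqrt L by rewrite -expr2 sqr_sqrtr// ltW.
have lnLE : ln L = 2 * ln (Num.sqrt L) by rewrite {1}LE lnM ?posrE//; ring.
have hs : 2 * A / e <= Num.sqrt L.
  rewrite -(@ger0_norm _ (2 * A / e)); last by rewrite divr_ge0 ?mulr_ge0// ltW.
  rewrite -sqrtr_sqr; apply: ler_wsqrtr.
  by near: L; apply: nbhs_pinfty_ge; rewrite num_real.
have := ltW (ln_sublinear sL); rewrite -(ler_pM2l A0) => hA.
apply: (@le_trans _ _ (2 * A * Num.sqrt L)); first by rewrite lnLE; lra.
rewrite [in leRHS]LE mulrA ler_wpM2r ?(ltW sL)//.
by rewrite -ler_pdivrMl// mulrC.
Unshelve. all: end_near. Qed.

Section tail.
Context {R : realType} (p al a x0 : R) (H h : R -> R).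
Hypotheses (p1 : 1 < p) (al0 : 0 < al) (a0 : 0 < a) (H0 : forall x, 0 <= H x).
Hypothesis Hp : tail_profile R p al a x0 H h.

Lemma tail_decay x t : x <= x0 -> 0 <= t -> H (x - t) <= expR (- (al * t)) * H x.
Proof.
case: Hp => h1 hT _ xx0 t0; apply: le_trans (hT _ _ xx0 t0) _.
rewrite ler_wpM2r// ler_expR lerN2 ler_peMr//; first by rewrite mulr_ge0// ltW.
apply: (@le_trans _ _ (1 `^ (p - 1))); first by rewrite powR1.
have hx := h1 _ xx0.
by apply: ge0_ler_powR; rewrite ?nnegrE ?subr_ge0 ?(ltW p1)//; lra.
Qed.

Lemma tail_support_ge L y : (forall x, H x <= 1) -> 0 <= L -> expR (- L) <= H y ->
  x0 - L / al <= y.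
Proof.
move=> H1 L0 Hy; have Lal : 0 <= L / al by rewrite divr_ge0// ltW.
have [yx0|x0y] := leP y x0; last by lra.
have := tail_decay x0 (x0 - y) (lexx _); rewrite subr_ge0 subKr => /(_ yx0) h2.
have : expR (- L) <= expR (- (al * (x0 - y))).
  apply: le_trans Hy _; apply: le_trans h2 _.
  by rewrite ler_piMr ?expR_ge0.
rewrite ler_expR lerN2 => h3.
suff : x0 - y <= L / al by lra.
by rewrite ler_pdivlMr// mulrC.
Qed.

(** With [s = al * (y - x) <= al], decay gives [H x <= expR (- s) * H y], and [expR (- s) <= 1 / (1
    + s) <= 1 - s / (1 + al)]. *)
Lemma tail_increment x y : x <= y -> y <= x0 -> y - x <= 1 ->
  al / (1 + al) * (y - x) * H y <= H y - H x.
Proof.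
have al0' := al0.
move=> xy yx0 yx1; have yx : 0 <= y - x by rewrite subr_ge0.
have := tail_decay _ _ yx0 yx; rewrite subKr => h1.
suff h2 : expR (- (al * (y - x))) <= 1 - al / (1 + al) * (y - x).
  by have := ler_wpM2r (H0 y) h2; lra.
have s0 : 0 <= al * (y - x) by rewrite mulr_ge0// ltW.
have s1 : al * (y - x) <= al by rewrite ler_piMr// ltW.
set s := al * (y - x) in s0 s1 *.
have -> : al / (1 + al) * (y - x) = s / (1 + al) by rewrite mulrAC.
rewrite expRN; have := expR_ge1Dx s => h3.
apply: (@le_trans _ _ (1 + s)^-1); first by rewrite lef_pV2 ?posrE ?expR_gt0; lra.
rewrite lerBrDr -lerBrDl.
have -> : 1 - (1 + s)^-1 = s / (1 + s) by field; lra.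
by rewrite ler_wpM2l// lef_pV2 ?posrE; lra.
Qed.

Lemma tail_gt0 : 0 < H x0.
Proof.
case: Hp => _ _ /(_ (x0 - 1) x0).
rewrite gerBl ler01 lexx subKr mul1r => /(_ isT isT).
have := H0 (x0 - 1); have : 0 < a * expR (- h (x0 - 1) `^ p) by rewrite mulr_gt0 ?expR_gt0.
by lra.
Qed.

End tail.

(* Either the gap is at most [1/L], or the density bound on the right half of
   the gap forces [h] to be at least of order [L^(1/p)] at its midpoint, and the
   decay at that rate over the left half bounds the gap. *)
Lemma tail_quantile_gap {R : realType} (p al a x0 : R) (H h : R -> R)
    (p1 : 1 < p) (al0 : 0 < al) (a0 : 0 < a) (H0 : forall x, 0 <= H x)
    (Hp : tail_profile R p al a x0 H h) (A B : R) :
  {homo H : x y / x <= y} -> 0 <= A -> 0 <= B ->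
  exists K, 0 < K /\ \forall L \near +oo, forall y1 y2, y1 <= y2 ->
    L `^ (- B) * expR (- L) <= H y1 -> H y2 <= L `^ A * expR (- L) ->
    y2 - y1 <= K * (ln L / L `^ (1 - p^-1)).
Proof.
move=> Hm A0 B0; have p0 : 0 < p by exact: lt_trans p1.
have [th thE] : exists t, t = 1 - p^-1 by eexists.
have th0 : 0 < th by rewrite thE subr_gt0 invf_lt1.
have th1 : th <= 1 by rewrite thE gerBl invr_ge0 ltW.
rewrite -thE.
have AB0 : 0 <= A + B by rewrite addr_ge0.
have [K' K'E] : exists t, t = 4 * (A + B) / al by eexists.
have K'0 : 0 <= K' by rewrite K'E divr_ge0 ?mulr_ge0 ?(ltW al0).
(* The summand 1 serves gaps up to [1/L], which is at most [ln L / L^th]; [K'] serves the others. *)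
exists (1 + K'); split; first by clear -K'0; lra.
near=> L => y1 y2 y12 Hy1 Hy2.
have L1 : expR 1 <= L by near: L; apply: nbhs_pinfty_ge; rewrite num_real.
have hA2 : A * ln L <= 2^-1 * L by near: L; apply: near_pinfty_ln_le; rewrite invr_gt0.
have hA4 : (A + 1) * ln L <= 4^-1 * L by near: L; apply: near_pinfty_ln_le; rewrite invr_gt0.
have hx0 : - ln (H x0) * 2 + 1 <= L by near: L; apply: nbhs_pinfty_ge; rewrite num_real.
have ha : - ln (a / 2) * 4 <= L by near: L; apply: nbhs_pinfty_ge; rewrite num_real.
have L0 : 0 < L by rewrite (lt_le_trans _ L1)// expR_gt0.
have lnL1 : 1 <= ln L by rewrite -(@expRK R 1) ler_ln ?posrE// expR_gt0.
have powE e : L `^ e = expR (e * ln L) by rewrite /powR gt_eqF.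
have Lth0 : 0 < L `^ th by rewrite powR_gt0.
have Lge1 : 1 <= L by apply: le_trans L1; rewrite -[leLHS]expR0 ler_expR.
have LthL : L `^ th <= L by rewrite -[leRHS]powRr1 ?(ltW L0)// ler_powR.
have [gapL|gapL] := leP (y2 - y1) L^-1.
  apply: le_trans gapL _; rewrite -[leLHS]mul1r; apply: ler_pM => //.
  - by rewrite invr_ge0 ltW.
  - by rewrite lerDl.
  - by rewrite -[leLHS]mul1r ler_pM ?invr_ge0 ?(ltW L0)// lef_pV2.
have y2x0 : y2 <= x0.
  rewrite leNgt; apply/negP => /ltW/Hm.
  apply/negP; rewrite -ltNge; apply: le_lt_trans Hy2 _.
  rewrite powE -expRD -[ltRHS]lnK ?posrE ?(tail_gt0 p al a x0 H h)// ltr_expR.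
  by clear -hA2 hx0; lra.
have [z [zy1 y2z y1z]] : exists z, [/\ y1 <= z <= y2, y2 - z = (y2 - y1) / 2 &
    z - y1 = (y2 - y1) / 2].
  by exists ((y1 + y2) / 2); clear -y12; split; lra.
have /andP[y1lez zy2] := zy1.
have zx0 : z <= x0 by rewrite (le_trans zy2).
have [h1 hT hD] := Hp.
(* Taking logarithms in the mass bound on [[z, y2]] costs [(A + 1) ln L - ln (a / 2)], at most
   [L / 2] by [hA4] and [ha]. *)
have hzL : 2^-1 * L <= h z `^ p.
  have hd := hD _ _ zy2 y2x0; have Hz0 := H0 z; rewrite y2z in hd.
  have : L^-1 / 2 * (a * expR (- h z `^ p)) <= L `^ A * expR (- L).
    apply: (@le_trans _ _ ((y2 - y1) / 2 * (a * expR (- h z `^ p)))).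
      by rewrite ler_wpM2r ?mulr_ge0 ?expR_ge0 ?(ltW a0)// ler_pM2r ?invr_gt0// ltW.
    by clear -hd Hz0 Hy2; lra.
  have -> : L^-1 / 2 * (a * expR (- h z `^ p)) =
     expR (- ln L + ln (a / 2) - h z `^ p).
    by rewrite !expRD (expRN (ln L)) !lnK ?posrE ?divr_gt0//; clear; lra.
  by rewrite powE -expRD ler_expR; clear -hA4 ha; lra.
have hz0 : 0 <= h z by rewrite (le_trans ler01)// h1.
(* The exponent [1 - 1/p] arises here: [h^(p-1) = (h^p)^th >= (L/2)^th >= L^th / 2]. *)
have hzth : 2^-1 * L `^ th <= h z `^ (p - 1).
  have -> : p - 1 = p * th by rewrite thE mulrBr mulr1 divff// gt_eqF.
  rewrite powRrM; apply: (@le_trans _ _ ((2^-1 * L) `^ th)).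
    rewrite powRM ?invr_ge0 ?ler0n ?(ltW L0)// ler_wpM2r ?powR_ge0//.
    by apply: ger1_powR; [clear; apply/andP; split; lra|].
  apply: ge0_ler_powR; rewrite ?nnegrE ?powR_ge0 ?(ltW th0)//.
  by rewrite mulr_ge0 ?invr_ge0// ltW.
have zy0 : 0 <= z - y1 by rewrite subr_ge0.
have := hT z (z - y1) zx0 zy0; rewrite subKr => hTz.
(* The factors [expR (- L)] of the two levels cancel, leaving [(A + B) ln L] against
   [al * (gap / 2) * (L^th / 2)]; hence the 4 in [K']. *)
have : expR (- B * ln L - L) <= expR (- (al * (z - y1) * h z `^ (p - 1)) + (A * ln L - L)).
  rewrite !expRD -!powE; apply: le_trans Hy1 _; apply: le_trans hTz _.
  by rewrite ler_wpM2l ?expR_ge0//; exact: le_trans (Hm _ _ zy2) _.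
rewrite ler_expR => hexp.
have hfin := ler_wpM2l (mulr_ge0 (ltW al0) zy0) hzth.
rewrite y1z in hfin hexp.
have hle : al * (y2 - y1) * L `^ th <= 4 * (A + B) * ln L by clear -hfin hexp; lra.
rewrite mulrA ler_pdivlMr//.
have : (y2 - y1) * L `^ th <= K' * ln L.
  by rewrite K'E mulrAC ler_pdivlMr//; clear -hle; lra.
by clear -lnL1; lra.
Unshelve. all: end_near. Qed.

(** * Regularity of the distribution function, both tails combined *)

Section regularity.
Context {R : realType} (p a : R) (g : R -> R) (mu : probability (measurableTypeR R) R).
Hypotheses (p1 : 1 < p) (a0 : 0 < a) (g0 : forall x, 0 <= g x).
Hypothesis cg : convex_function (setT : set R^o) g.
Hypothesis muE : forall A : set (measurableTypeR R), measurable A ->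
  mu A = (\int[lebesgue_measure]_(x in A) (a * expR (- (g x `^ p)))%:E)%E.
Local Notation F := (cdf_of mu).
Local Notation m y := (Num.min (F y) (1 - F y)).

Let ccdf_ge0 x : 0 <= 1 - F (- x).
Proof. by rewrite subr_ge0 cdf_of_le1. Qed.

Let ccdf_homo : {homo (fun x => 1 - F (- x)) : x y / x <= y}.
Proof. by move=> x y xy; have := cdf_of_homo mu (- y) (- x); lra. Qed.

(** An interval of length at most 1 lies in the left tail, in the right tail, or in
    [[x1 - 1, - x2 + 1]], where convexity bounds [g] by its endpoint values and so the density from
    below. Having the bound at both ends lets steps to the left and to the right of a point [y] both
    be measured by [m y]. *)
Lemma cdf_of_increment_min : exists c, 0 < c /\ forall x r, 0 <= r <= 1 ->
  c * r * m x <= F (x + r) - F x /\ c * r * m (x + r) <= F (x + r) - F x.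
Proof.
have [al1 [x1 [al10 H1]]] := left_tail_profile p a g mu p1 a0 g0 cg muE.
have [al2 [x2 [al20 H2]]] := right_tail_profile p a g mu p1 a0 g0 cg muE.
pose G := Num.max (g (x1 - 1)) (g (- x2 + 1)).
pose b := a * expR (- (G `^ p)).
have b0 : 0 < b by rewrite mulr_gt0 ?expR_gt0.
pose c := Num.min b (Num.min (al1 / (1 + al1)) (al2 / (1 + al2))).
have c0 : 0 < c by rewrite !lt_min b0 !divr_gt0//; lra.
have cb : c <= b by rewrite ge_min lexx.
have c1 : c <= al1 / (1 + al1) by rewrite !ge_min lexx !orbT.
have c2 : c <= al2 / (1 + al2) by rewrite !ge_min lexx !orbT.
exists c; split => // x r /andP[r0 r1].
have Fr : F x <= F (x + r) by apply: cdf_of_homo; lra.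
have F0 := cdf_of_ge0 mu; have F1 := cdf_of_le1 mu.
suff [e [mx my ce]] : exists e, [/\ m x <= e, m (x + r) <= e &
    c * r * e <= F (x + r) - F x].
  by split; apply: le_trans ce; rewrite ler_wpM2l// mulr_ge0// ltW.
have [h1|h1] := leP (x + r) x1.
  exists (F (x + r)); split; rewrite ?ge_min ?Fr ?lexx//.
  have := tail_increment p al1 a x1 F g p1 al10 F0 H1 x (x + r).
  rewrite addrAC subrr add0r lerDl => /(_ r0 h1 r1); apply: le_trans.
  by rewrite !ler_wpM2r.
have [h2|h2] := leP (- x2) x.
  exists (1 - F x); split; rewrite ?ge_min ?lexx ?orbT//.
    by apply/orP; right; lra.
  have := tail_increment p al2 a x2 _ _ p1 al20 ccdf_ge0 H2 (- (x + r)) (- x).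
  rewrite !opprK => /(_ ltac:(lra) ltac:(lra) ltac:(lra)) h.
  apply: (@le_trans _ _ (al2 / (1 + al2) * r * (1 - F x))); last by move: h; lra.
  by rewrite !ler_wpM2r//; have := F1 x; lra.
exists 1; split; rewrite ?ge_min ?F1//.
have xr : x <= x + r by lra.
have := cdf_of_increment p a g mu p1 a0 g0 cg muE x (x + r) G xr.
rewrite -/b => h; rewrite mulr1.
apply: (@le_trans _ _ ((x + r - x) * b)); first by rewrite addrAC subrr add0r mulrC ler_wpM2l.
apply: h => u /andP[xu ux].
have l1 : x1 - 1 <= u by lra.
have l2 : u <= - x2 + 1 by lra.
have := convex_function_three_points _ _ _ _ _ cg l1 l2.
have gG1 : g (x1 - 1) <= G by rewrite le_max lexx.
have gG2 : g (- x2 + 1) <= G by rewrite le_max lexx orbT.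
have [lt12|ge12] := ltP (x1 - 1) (- x2 + 1); last first.
  by have -> : u = x1 - 1 by lra.
have d0 : 0 < - x2 + 1 - (x1 - 1) by lra.
move=> h3; rewrite -(ler_pM2l d0); apply: le_trans h3 _.
have w1 : 0 <= - x2 + 1 - u by lra.
have w2 : 0 <= u - (x1 - 1) by lra.
by have := ler_wpM2l w1 gG1; have := ler_wpM2l w2 gG2; lra.
Qed.

(** Exponential decay of each tail bounds [y] on one side; [1 <= L] absorbs the offsets [x1] and
    [x2]. This controls the extent of the grid. *)
Lemma cdf_of_quantile_bound : exists K, 0 < K /\ forall L y, 1 <= L ->
  expR (- L) <= F y -> expR (- L) <= 1 - F y -> `|y| <= K * L.
Proof.
have [al1 [x1 [al10 H1]]] := left_tail_profile p a g mu p1 a0 g0 cg muE.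
have [al2 [x2 [al20 H2]]] := right_tail_profile p a g mu p1 a0 g0 cg muE.
have i1 : 0 < al1^-1 by rewrite invr_gt0.
have i2 : 0 < al2^-1 by rewrite invr_gt0.
have [n1 n2] : 0 <= `|x1| /\ 0 <= `|x2| by [].
exists (`|x1| + `|x2| + al1^-1 + al2^-1); split; first by lra.
move=> L y L1 Fy Sy; have L0 : 0 <= L by lra.
have := tail_support_ge p al1 a x1 F g p1 al10 (cdf_of_ge0 mu) H1 L y
  (cdf_of_le1 mu) L0 Fy.
have S1 x : 1 - F (- x) <= 1 by have := cdf_of_ge0 mu (- x); lra.
have := tail_support_ge p al2 a x2 _ _ p1 al20 ccdf_ge0 H2 L (- y) S1 L0.
rewrite /= opprK => /(_ Sy) h2 h1.
have e1 := ler_peMr n1 L1; have e2 := ler_peMr n2 L1.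
have a1 := mulr_ge0 (ltW i1) L0; have a2 := mulr_ge0 (ltW i2) L0.
have : - `|x1| <= x1 by rewrite lerNl -normrN ler_norm.
have : - `|x2| <= x2 by rewrite lerNl -normrN ler_norm.
by rewrite ler_norml; lra.
Qed.

Lemma cdf_of_quantile_gap (A B : R) : 0 <= A -> 0 <= B ->
  exists K, 0 < K /\ \forall L \near +oo, forall y1 y2, y1 <= y2 ->
    (L `^ (- B) * expR (- L) <= F y1 -> F y2 <= L `^ A * expR (- L) ->
      y2 - y1 <= K * (ln L / L `^ (1 - p^-1))) /\
    (L `^ (- B) * expR (- L) <= 1 - F y2 -> 1 - F y1 <= L `^ A * expR (- L) ->
      y2 - y1 <= K * (ln L / L `^ (1 - p^-1))).
Proof.
move=> A0 B0.
have [al1 [x1 [al10 H1]]] := left_tail_profile p a g mu p1 a0 g0 cg muE.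
have [al2 [x2 [al20 H2]]] := right_tail_profile p a g mu p1 a0 g0 cg muE.
have [K1 [K10 h1]] := tail_quantile_gap p al1 a x1 F g p1 al10 a0 (cdf_of_ge0 mu) H1
  A B (cdf_of_homo mu) A0 B0.
have [K2 [K20 h2]] := tail_quantile_gap p al2 a x2 _ _ p1 al20 a0 ccdf_ge0 H2
  A B ccdf_homo A0 B0.
exists (K1 + K2); split; first by lra.
apply: filterS3 (nbhs_pinfty_ge (num_real 1)) h1 h2 => L L1 {}h1 {}h2 y1 y2 y12.
have s0 : 0 <= ln L / L `^ (1 - p^-1) by rewrite divr_ge0 ?powR_ge0 ?ln_ge0.
have w1 := mulr_ge0 (ltW K10) s0; have w2 := mulr_ge0 (ltW K20) s0.
split=> hB hA.
  by have := h1 y1 y2 y12 hB hA; rewrite mulrDl; lra.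
have := h2 (- y2) (- y1); rewrite !opprK => /(_ ltac:(lra) hB hA).
by rewrite mulrDl; lra.
Qed.

(** Intermediate values, between explicit points supplied by exponential decay: a shift by
    [- ln u / al1] brings the left tail down to at most [u], and similarly on the right. *)
Lemma cdf_of_quantile_exists u : continuous F -> 0 < u -> u < 1 -> exists x, F x = u.
Proof.
move=> Fc u0 u1.
have [al1 [x1 [al10 H1]]] := left_tail_profile p a g mu p1 a0 g0 cg muE.
have [al2 [x2 [al20 H2]]] := right_tail_profile p a g mu p1 a0 g0 cg muE.
have dec (al w : R) : 0 < al -> 0 < w -> w < 1 ->
    0 <= - ln w / al /\ expR (- (al * (- ln w / al))) = w.
  move=> al0 w0 w1; split.
    by rewrite divr_ge0 ?(ltW al0)// oppr_ge0 ln_le0// ltW.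
  by rewrite mulrC divfK ?gt_eqF// opprK lnK.
have [t10 t1E] := dec _ _ al10 u0 u1.
have [t20 t2E] := dec al2 (1 - u) al20 ltac:(lra) ltac:(lra).
set t1 := - ln u / al1 in t10 t1E; set t2 := - ln (1 - u) / al2 in t20 t2E.
have := tail_decay p al1 a x1 F g p1 al10 (cdf_of_ge0 mu) H1 x1 t1 (lexx _) t10.
rewrite t1E => hl.
have := tail_decay p al2 a x2 _ _ p1 al20 ccdf_ge0 H2 x2 t2 (lexx _) t20.
rewrite /= t2E => hr.
have l1 : F (x1 - t1) <= u.
  by apply: le_trans hl _; rewrite ler_piMr ?(ltW u0)// cdf_of_le1.
have l2 : u <= F (- (x2 - t2)).
  have : 1 - F (- (x2 - t2)) <= 1 - u; last by lra.
  apply: le_trans hr _; rewrite ler_piMr//; first by lra.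
  by have := cdf_of_ge0 mu (- x2); lra.
(* The maximum with [lo] guarantees [lo <= hi], the two tail points having no known order. *)
pose lo := x1 - t1; pose hi := Num.max lo (- (x2 - t2)).
have lohi : lo <= hi by rewrite le_max lexx.
have l3 : u <= F hi by apply: le_trans l2 _; apply: cdf_of_homo; rewrite le_max lexx orbT.
have [||x _ Fx] := @IVT R F lo hi u lohi.
- by apply: continuous_subspaceT.
- by rewrite ge_min l1 le_max l3 orbT.
- by exists x.
Qed.

End regularity.

Lemma inverse_funK (R : realType) (F : R -> R) (u : R) :
  (exists x, F x = u) -> F (inverse_fun F u) = u.
Proof. by move=> [x Fx]; apply: pinvK; rewrite inE; exists x. Qed.

(** * Empirical counts and order statistics *)

(** Pairwise products determine the second moment, so pairwise independence gives the variance
    [n u (1 - u)]. *)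
Lemma indic_sum_chebyshev d (T : measurableType d) (R : realType)
    (P : probability T R) (n : nat) (A : 'I_n -> set T) (u s : R) :
  0 <= u -> 0 < s -> (forall j, measurable (A j)) -> (forall j, P (A j) = u%:E) ->
  (forall j k, j != k -> P (A j `&` A k) = (u ^+ 2)%:E) ->
  (P [set w | (s <= `|\sum_(j < n) \1_(A j) w - n%:R * u|)%R]
   <= (n%:R * (u * (1 - u)) / s ^+ 2)%:E)%E.
Proof.
move=> u0 s0 mA PA PAA.
pose N w : R := \sum_(j < n) \1_(A j) w.
have N0 w : 0 <= N w by apply: sumr_ge0 => j _; rewrite indicE.
have mN : measurable_fun [set: T] N.
  by apply: measurable_sum => j; exact: measurable_indic.
have mY2 : measurable_fun [set: T] (fun w => ((N w - n%:R * u) ^+ 2)%:E).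
  apply/measurable_EFinP; apply: measurable_funX; apply: measurable_funB => //.
have iI (B : set T) : measurable B -> (\int[P]_w (\1_B w)%:E = P B)%E.
  by move=> mB; rewrite integral_indic// setIT.
have iN : (\int[P]_w (N w)%:E = (n%:R * u)%:E)%E.
  under eq_integral do rewrite /N -sumEFin.
  rewrite ge0_integral_sum//; last by move=> j; apply/measurable_EFinP; exact: measurable_indic.
  under eq_bigr do rewrite iI// PA.
  by rewrite sumEFin sumr_const card_ord mulr_natl.
have iN2 : (\int[P]_w ((N w) ^+ 2)%:E = (n%:R * u + n%:R * (n%:R - 1) * u ^+ 2)%:E)%E.
  have NE w : ((N w) ^+ 2)%:E =
      (\sum_(j < n) \sum_(k < n) (\1_(A j `&` A k) w)%:E)%E.
    rewrite expr2 /N mulr_suml -sumEFin; apply: eq_bigr => j _.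
    by rewrite mulr_sumr -sumEFin; apply: eq_bigr => k _; rewrite indicI.
  under eq_integral do rewrite NE.
  rewrite ge0_integral_sum//; last 2 first.
  - move=> j; apply: emeasurable_sum => k; apply/measurable_EFinP.
    by apply: measurable_indic; exact: measurableI.
  - by move=> j w _; apply: sume_ge0 => k _; rewrite lee_fin indicE.
  have inner (j : 'I_n) : (\int[P]_w (\sum_(k < n) (\1_(A j `&` A k) w)%:E) =
      (u + (n%:R - 1) * u ^+ 2)%:E)%E.
    rewrite ge0_integral_sum//; last first.
      move=> k; apply/measurable_EFinP.
      by apply: measurable_indic; exact: measurableI.
    rewrite (bigD1 j)//= iI; last exact: measurableI.
    rewrite setIid PA EFinD; congr (_ + _)%E.
    under eq_bigr => k kj.
      rewrite iI; last exact: measurableI.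
      by rewrite PAA 1?eq_sym//; over.
    rewrite sumEFin sumr_const cardC1 card_ord. rewrite -[_ *+ n.-1]mulr_natl -subn1 natrB//.
    by rewrite (leq_ltn_trans _ (ltn_ord j)).
  under eq_bigr do rewrite inner.
  by rewrite sumEFin sumr_const card_ord -[_ *+ n]mulr_natl; congr EFin; ring.
have nu0 : 0 <= n%:R * u by rewrite mulr_ge0.
(* The cross term is added on the left so that all integrands are nonnegative. *)
have expand : (\int[P]_w ((N w - n%:R * u) ^+ 2)%:E + (2 * (n%:R * u) * (n%:R * u))%:E =
    (n%:R * u + n%:R * (n%:R - 1) * u ^+ 2 + (n%:R * u) ^+ 2)%:E)%E.
  rewrite [X in (_ + X)%E]EFinM -iN -ge0_integralZl//=; last 3 first.
  - exact/measurable_EFinP.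
  - by move=> w _; rewrite lee_fin.
  - by rewrite lee_fin mulr_ge0.
  rewrite -ge0_integralD//=; last 3 first.
  - by move=> w _; rewrite lee_fin sqr_ge0.
  - by move=> w _; rewrite lee_fin mulr_ge0// mulr_ge0.
  - by apply: measurable_funeM; exact/measurable_EFinP.
  rewrite EFinD -iN2 (_ : (_ ^+ 2)%:E = \int[P]_w (cst ((n%:R * u) ^+ 2)%:E w))%E; last first.
    by rewrite integral_cst//; apply: esym; rewrite -[RHS]mule1; congr (_ * _)%E; exact: probability_setT.
  rewrite -ge0_integralD//=; last 3 first.
  - by move=> w _; rewrite lee_fin sqr_ge0.
  - by apply/measurable_EFinP; exact: measurable_funX.
  - by move=> w _; rewrite lee_fin sqr_ge0.
  by apply: eq_integral => w _; rewrite -!EFinM -!EFinD; congr EFin; ring.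
have iY2 : (\int[P]_w ((N w - n%:R * u) ^+ 2)%:E = (n%:R * (u * (1 - u)))%:E)%E.
  have : (\int[P]_w ((N w - n%:R * u) ^+ 2)%:E =
     (n%:R * u + n%:R * (n%:R - 1) * u ^+ 2 + (n%:R * u) ^+ 2)%:E -
     (2 * (n%:R * u) * (n%:R * u))%:E)%E by rewrite -expand addeK.
  by move=> ->; rewrite -EFinB; congr EFin; ring.
set E := [set w | _].
have mE : measurable E.
  rewrite -[E]setTI; apply: measurable_fun_ler => //.
  apply: measurableT_comp => //; apply: measurable_funB => //; exact: measurable_cst.
have s20 : 0 < s ^+ 2 by rewrite exprn_gt0.
rewrite EFinM lee_pdivlMr// -iY2 muleC -(setIT E) -integral_indic//.
rewrite -ge0_integralZl//=; last 2 first.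
- by apply/measurable_EFinP; exact: measurable_indic.
- by rewrite lee_fin ltW.
apply: ge0_le_integral => //=.
- by move=> w _; rewrite lee_fin mulr_ge0 ?indicE// ltW.
- by apply: measurable_funeM; apply/measurable_EFinP; exact: measurable_indic.
- move=> w _; rewrite -EFinM lee_fin indicE; have [|] := boolP (w \in E).
    rewrite inE /E/= -/(N w) => h; rewrite mulr1 -[leRHS]real_normK ?num_real//.
    by rewrite ler_pXn2r ?nnegrE// ltW.
  by rewrite mulr0 sqr_ge0.
Qed.

(** This is [n] times the empirical distribution function at [y]. *)
Definition count_le (R : realType) (n : nat) (x : 'I_n -> R) (y : R) : nat :=
  \sum_(j < n) (x j <= y)%R.

Lemma sorted_nth_le (R : realType) (s : seq R) (i : nat) (y : R) :
  sorted <=%R s -> (i < size s)%N ->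
  (nth 0 s i <= y) = (i < count (<= y) s)%N.
Proof.
elim: s i => //= b s IH i bs.
have sb : all (>= b) s by apply: order_path_min bs => ? ? ?; exact: le_trans.
have [yb|by'] := leP b y.
  by case: i => [|i]//=; rewrite ltnS => /IH ->//; exact: path_sorted bs.
have c0 : count (<= y) s = 0%N.
  apply/eqP; rewrite -leqn0 leqNgt -has_count; apply/hasPn => z /(allP sb) bz.
  by rewrite /= -ltNge (lt_le_trans by').
rewrite c0 addn0 => iS; apply/negbTE; rewrite -ltNge; apply: lt_le_trans by' _.
by case: i iS => //= i; rewrite ltnS => iS; apply: (allP sb); exact: mem_nth.
Qed.

(** The duality that converts deviations of counts into deviations of order statistics; the
    inequality is strict because [i] counts from 0. *)
Lemma order_stat_le (R : realType) (n : nat) (x : 'I_n -> R) (i : 'I_n) (y : R) :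
  (order_stat x i <= y) = (i < count_le R n x y)%N.
Proof.
rewrite /order_stat sorted_nth_le; [|exact: sort_le_sorted|by rewrite size_sort size_map size_enum_ord].
rewrite count_sort count_map /count_le; congr (_ < _)%N.
by rewrite -sum1_count big_mkcond/= big_enum/=; apply: eq_bigr => j _; case: (_ <= _).
Qed.

Lemma order_stat_gt (R : realType) (n : nat) (x : 'I_n -> R) (i : 'I_n) (y : R) :
  (forall j, y < x j) -> y < order_stat x i.
Proof.
move=> H; rewrite ltNge order_stat_le -leqNgt /count_le big1// => j _.
by rewrite leNgt H.
Qed.

Lemma order_stat_le_all (R : realType) (n : nat) (x : 'I_n -> R) (i : 'I_n) (y : R) :
  (forall j, x j <= y) -> order_stat x i <= y.
Proof.
move=> H; rewrite order_stat_le /count_le (eq_bigr (fun=> 1%N)) ?sum1_card ?card_ord//.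
by move=> j _; rewrite H.
Qed.

(** The grid is indexed by naturals through a shift by [M], which also makes [x / r + M]
    nonnegative, so that truncation acts as a floor. *)
Lemma grid_point (R : realType) (M : nat) (r x : R) : 0 < r ->
  - (M%:R * r) <= x -> x + r <= M%:R * r ->
  exists2 k : nat, (k < (2 * M).+1)%N &
    x <= (k%:R - M%:R) * r /\ (k%:R - M%:R) * r <= x + r.
Proof.
move=> r0 xM Mx.
pose t := x / r + M%:R.
have xE : x = (t - M%:R) * r by rewrite /t addrK divfK// gt_eqF.
have t0 : 0 <= t by rewrite -(@pmulr_lge0 _ r)//; lra.
have tM : t + 1 <= 2 * M%:R by rewrite -(ler_pM2r r0); lra.
have /andP[k1 k2] := truncn_itv t0.
exists (Num.truncn t).+1.
  rewrite ltnS -(ler_nat R) natrM -[_.+1]addn1 natrD; lra.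
rewrite -[_.+1]addn1 natrD xE !ler_pM2r//.
rewrite (_ : (t - M%:R) * r + r = (t + 1 - M%:R) * r) ?ler_pM2r//; last by ring.
by move: k2; rewrite -natr1 => k2; lra.
Qed.

(* A grid point at distance about [r] from a quantile has an empirical count on
   the correct side; quantiles outside the grid are within [D] of the range of
   the whole sample. *)
Lemma order_stat_near_quantile (R : realType) (F : R -> R) (n M : nat)
    (x : 'I_n -> R) (r D ym yp zp zm v : R) (i : 'I_n) :
  {homo F : a b / a <= b} -> 0 < r -> 0 <= D ->
  yp - ym <= D -> zm - zp <= D ->
  - (M%:R * r) <= yp -> zp <= M%:R * r ->
  (forall k, (k < (2 * M).+1)%N -> let y := (k%:R - M%:R) * r in
    yp <= y <= zp ->
    n.+1%:R * F (y - r) < (count_le R n x y)%:R < n.+1%:R * F (y + r)) ->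
  (forall j, ym < x j <= zm) ->
  ym <= v <= zm -> F v = i.+1%:R / n.+1%:R ->
  `|order_stat x i - v| <= 2 * D + 2 * r.
Proof.
move=> Fm r0 D0 ymp zmp ypM zpM grid xr /andP[ymv vzm] Fv.
have nF : n.+1%:R * F v = i.+1%:R by rewrite Fv mulrC divfK// pnatr_eq0.
have n0 : 0 <= n.+1%:R :> R by [].
have xgt := order_stat_gt R n x i ym (fun j => proj1 (andP (xr j))).
have xle := order_stat_le_all R n x i zm (fun j => proj2 (andP (xr j))).
rewrite ler_norml; apply/andP; split.
- pose b := Num.min (v - r) zp.
  have bv : b <= v - r by rewrite ge_min lexx.
  have bz : b <= zp by rewrite ge_min lexx orbT.
  have vb : v - r - D <= b by rewrite le_min; lra.
  (* Below the grid the sample bound [ym >= yp - D] is used; together with the [D] lost in [vb] it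
     accounts for [2 * D]. Otherwise a grid point [y] in [[b - r, b]] has [y + r <= v], so its count
     is below [i + 1] and the order statistic exceeds [y]. *)
  have [ypb|byp] := leP yp (b - r); last by lra.
  have [k kM [k1 k2]] := grid_point R M r (b - r) r0 ltac:(lra) ltac:(lra).
  have /= := grid k kM; rewrite (le_trans ypb k1)/= => /(_ ltac:(lra))/andP[_].
  set y := (_ - _) * r in k1 k2 * => Ny.
  have : n.+1%:R * F (y + r) <= n.+1%:R * F v by rewrite ler_wpM2l// Fm//; lra.
  rewrite nF => /(lt_le_trans Ny); rewrite ltr_nat ltnS leqNgt -order_stat_le -ltNge.
  by lra.
- pose b := Num.max (v + r) yp.
  have bv : v + r <= b by rewrite le_max lexx.
  have bz : yp <= b by rewrite le_max lexx orbT.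
  have vb : b <= v + r + D by rewrite ge_max; lra.
  have [ypb|bzp] := leP (b + r) zp; last by lra.
  have [k kM [k1 k2]] := grid_point R M r b r0 ltac:(lra) ltac:(lra).
  have /= := grid k kM; rewrite (le_trans bz k1)/= => /(_ ltac:(lra))/andP[+ _].
  set y := (_ - _) * r in k1 k2 * => Ny.
  have : n.+1%:R * F v <= n.+1%:R * F (y - r) by rewrite ler_wpM2l// Fm//; lra.
  rewrite nF => /le_lt_trans /(_ Ny); rewrite ltr_nat => /ltnW; rewrite -order_stat_le.
  by lra.
Qed.

(** * Concentration for an i.i.d. sample *)

Section sample.
Context {R : realType} (mu : probability (measurableTypeR R) R).
Context d (T : measurableType d) (P : probability T R) (n : nat).
Variable X : 'I_n -> {RV P >-> R}.
Hypothesis iid : iid_sample mu X.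
Local Notation F := (cdf_of mu).
Local Notation N y w := (count_le R n (fun j => X j w) y).

Lemma sample_law j (A : set R) : measurable A -> P (X j @^-1` A) = mu A.
Proof. by move=> mA; case: iid => _ /(_ j A mA). Qed.

Lemma measurable_sample_preimage j (A : set R) : measurable A ->
  measurable (X j @^-1` A).
Proof. by move=> mA; rewrite -[X in measurable X]setTI; exact: measurable_funPT. Qed.

Lemma sample_pair_independent j k (A : set R) : measurable A -> j != k ->
  P (X j @^-1` A `&` X k @^-1` A) = (mu A * mu A)%E.
Proof.
move=> mA jk; case: iid => /(_ [set j; k]%SET (fun=> A) (fun=> mA)) + _.
rewrite big_setU1/= ?inE// big_set1 !sample_law// => <-.
congr (P _); apply/seteqP; split => w /=.
  by move=> [wj wk] i /=; rewrite !inE => /orP[] /eqP->.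
by move=> h; split; apply: h => /=; rewrite !inE eqxx ?orbT.
Qed.

Lemma count_le_indic y w :
  (N y w)%:R = \sum_(j < n) \1_(X j @^-1` `]-oo, y]%classic) w :> R.
Proof.
rewrite /count_le natr_sum; apply: eq_bigr => j _.
rewrite indicE; congr (nat_of_bool _)%:R.
by apply/idP/idP; rewrite inE/= in_itv.
Qed.

Lemma count_le_chebyshev y s : 0 < s ->
  (P [set w | (s <= `|(N y w)%:R - n%:R * F y|)%R] <=
   (n%:R * (F y * (1 - F y)) / s ^+ 2)%:E)%E.
Proof.
move=> s0; have mI : measurable (`]-oo, y]%classic : set R) by [].
rewrite [X in (P X <= _)%E](_ : _ = [set w | (s <= `|\sum_(j < n)
    \1_(X j @^-1` `]-oo, y]%classic) w - n%:R * F y|)%R]); last first.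
  by apply/seteqP; split => w /=; rewrite count_le_indic.
apply: indic_sum_chebyshev => //; first exact: cdf_of_ge0.
- by move=> j; exact: measurable_sample_preimage.
- by move=> j; rewrite sample_law// cdf_ofE.
- by move=> j k jk; rewrite sample_pair_independent// cdf_ofE -EFinM.
Qed.

Lemma measurable_count_le y : measurable_fun [set: T] (fun w => (N y w)%:R : R).
Proof.
rewrite [X in measurable_fun _ X](_ : _ =
    (fun w => \sum_(j < n) \1_(X j @^-1` `]-oo, y]%classic) w)).
  apply: measurable_sum => j; apply: measurable_indic.
  exact: measurable_sample_preimage.
by apply/funext => w; rewrite count_le_indic.
Qed.

Lemma measurable_order_stat i :
  measurable_fun [set: T] (fun w => order_stat (fun j => X j w) i).
Proof.
apply: (measurability _ (RGenOInfty.measurableE R)) => // _ [_ [y ->] <-].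
rewrite setTI (_ : _ @^-1` _ = ~` [set w | (i.+1%:R <= ((N y w)%:R : R))%R]).
  apply: measurableC; rewrite -[X in measurable X]setTI.
  by apply: measurable_fun_ler => //; exact: measurable_count_le.
apply/seteqP; split => w /=; rewrite in_itv/= andbT.
  by move=> yo; apply/negP; rewrite ler_nat -order_stat_le -ltNge.
by move=> /negP; rewrite ler_nat -order_stat_le -ltNge.
Qed.

Lemma sample_boole (A : set R) : measurable A ->
  (P [set w | exists j, A (X j w)] <= n%:R%:E * mu A)%E.
Proof.
(* Boole's inequality takes a sequence indexed by [nat], so the events are extended by [set0]. *)
move=> mA; pose B (k : nat) := if insub k is Some j then X j @^-1` A else set0.
have mB k : measurable (B k).
  by rewrite /B; case: insub => // j; exact: measurable_sample_preimage.
rewrite (_ : [set w | _] = \big[setU/set0]_(k < n) B k); last first.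
  rewrite -bigcup_mkord; apply/seteqP; split => w /=.
    move=> [j Aj]; exists (nat_of_ord j); first exact: ltn_ord.
    by rewrite /B valK.
  by move=> [k /= kn]; rewrite /B insubT => Aj; exists (Sub k kn).
apply: (le_trans (@Boole_inequality _ _ _ P B n (fun k _ => mB k))).
rewrite (eq_bigr (fun=> mu A)) => [|j _]; last by rewrite /B valK; exact: sample_law.
by rewrite -(fineK (fin_num_measure mu _ mA)) sumEFin sumr_const card_ord -[_ *+ n]mulr_natl.
Qed.

(** A union bound over the failures of the deterministic estimate: a bad count at a grid point, or a
    sample point outside []ym, zm]]. *)
Lemma order_stat_concentration (M : nat) (r D ym yp zp zm b e : R)
    (s : R -> R) (v : 'I_n -> R) : (0 < n)%N ->
  0 < r -> 0 <= D -> yp - ym <= D -> zm - zp <= D ->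
  - (M%:R * r) <= yp -> zp <= M%:R * r -> 2 * D + 2 * r <= b -> 0 <= e ->
  (forall y, yp <= y <= zp -> [/\ 0 < s y,
     n.+1%:R * F (y - r) <= n%:R * F y - s y,
     n%:R * F y + s y <= n.+1%:R * F (y + r) &
     n%:R * (F y * (1 - F y)) / s y ^+ 2 <= e]) ->
  (forall i, ym <= v i <= zm /\ F (v i) = i.+1%:R / n.+1%:R) ->
  ((1 - ((2 * M).+1%:R * e + n%:R * F ym + n%:R * (1 - F zm)))%:E <=
   P [set w | (sup (range (fun i : 'I_n =>
      `|order_stat (fun j => X j w) i - v i|)) <= b)%R])%E.
Proof.
move=> n0 r0 D0 ymp zmp ypM zpM Db e0 Hs Hv.
pose y (k : nat) := (k%:R - M%:R) * r.
pose B k := if yp <= y k <= zp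
  then [set w | (s (y k) <= `|(N (y k) w)%:R - n%:R * F (y k)|)%R] else set0.
pose Lo := [set w | exists j, `]-oo, ym]%classic (X j w)].
pose Hi := [set w | exists j, `]zm, +oo[%classic (X j w)].
set E := [set w | _].
have mB k : measurable (B k).
  rewrite /B; case: ifP => // _; rewrite -[X in measurable X]setTI.
  apply: measurable_fun_ler => //.
  apply: measurableT_comp => //; apply: measurable_funB => //.
  exact: measurable_count_le.
have mex (A : set R) : measurable A -> measurable [set w | exists j, A (X j w)].
  move=> mA; rewrite (_ : [set w | _] = \bigcup_(j in [set: 'I_n]) (X j @^-1` A)).
    by apply: fin_bigcup_measurable => // j _; exact: measurable_sample_preimage.
  by apply/seteqP; split => w /= [j]; [exists j|move=> _; exists j].
have mLo : measurable Lo by exact: mex.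
have mHi : measurable Hi by exact: mex.
(* The family is finite and, by [0 < n], nonempty, so the bound on the supremum is a finite
   intersection of measurable events. *)
have EE : E = \bigcap_(i in [set: 'I_n])
    [set w | `|order_stat (fun j => X j w) i - v i| <= b].
  apply/seteqP; split => w /=.
    move=> hw i _ /=; apply: le_trans hw; apply: ub_le_sup; last by exists i.
    exists (\sum_j `|order_stat (fun j => X j w) j - v j|) => _ [k _ <-].
    by rewrite (bigD1 k)//= lerDl sumr_ge0.
  move=> hw; apply: ge_sup => [|_ [i _ <-]]; last exact: hw.
  by exists `|order_stat (fun j => X j w) (Ordinal n0) - v (Ordinal n0)|, (Ordinal n0).
have mE : measurable E.
  rewrite EE; apply: fin_bigcap_measurable => // i _.
  rewrite -[X in measurable X]setTI; apply: measurable_fun_ler => //.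
  apply: measurableT_comp => //; apply: measurable_funB => //.
  exact: measurable_order_stat.
pose U := \big[setU/set0]_(k < (2 * M).+1) B k `|` Lo `|` Hi.
have mU : measurable U.
  by apply: measurableU => //; apply: measurableU => //; exact: bigsetU_measurable.
have EU : ~` E `<=` U.
  apply: subsetCl => w nU; rewrite EE => i _ /=.
  have nB k : (k < (2 * M).+1)%N -> ~ B k w.
    move=> kM Bk; apply: nU; left; left.
    by rewrite -bigcup_mkord; exists k.
  apply: le_trans Db.
  have [vi Fvi] := Hv i.
  apply: (order_stat_near_quantile R F n M _ r D ym yp zp zm) => //.
  - by move=> a c ac; exact: cdf_of_homo.
  - move=> k kM /=; rewrite -/(y k) => yk.
    have [s0 h1 h2 _] := Hs _ yk.
    have := nB k kM; rewrite /B yk/= => /negP; rewrite -ltNge ltr_norml => /andP[l1 l2].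
    by apply/andP; split; lra.
  - move=> j; apply/andP; split.
      rewrite ltNge; apply/negP => jm; apply: nU; left; right; exists j.
      by rewrite /= in_itv.
    rewrite leNgt; apply/negP => jm; apply: nU; right; exists j.
    by rewrite /= in_itv/= andbT.
have PU : (P U <= ((2 * M).+1%:R * e + n%:R * F ym + n%:R * (1 - F zm))%:E)%E.
  apply: le_trans (measureU2 _ _ _) _ => //; first by apply: measurableU => //; exact: bigsetU_measurable.
  rewrite EFinD; apply: leeD; last first.
    by apply: le_trans (sample_boole _ _) _; rewrite ?cdf_of_setC.
  apply: le_trans (measureU2 _ _ _) _ => //; first exact: bigsetU_measurable.
  rewrite EFinD; apply: leeD; last first.
    by apply: le_trans (sample_boole _ _) _; rewrite ?cdf_ofE.
  apply: (le_trans (@Boole_inequality _ _ _ P B _ (fun k _ => mB k))).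
  apply: (@le_trans _ _ (\sum_(k < (2 * M).+1) e%:E)%E); last first.
    by rewrite sumEFin sumr_const card_ord -[_ *+ _]mulr_natl.
  apply: lee_sum => k _; rewrite /B; case: ifPn => [yk|_]; last by rewrite measure0 lee_fin.
  have [s0 _ _ h3] := Hs _ yk.
  by apply: le_trans (count_le_chebyshev _ _ s0) _; rewrite lee_fin.
have -> : P E = (1 - P (~` E))%E.
  by rewrite -[in LHS](setCK E) probability_setC//; exact: measurableC.
rewrite EFinB; apply: leeB => //.
by apply: le_trans PU; apply: le_measure; rewrite ?inE//; exact: measurableC.
Qed.

End sample.

(** * Asymptotics *)

(** With [u = t * ln L / 2], [L^t = expR u * expR u >= u^2], and [u^2 >= ln L] once
    [ln L >= 4 / t^2]. *)
Lemma near_pinfty_ln_le_powR (R : realType) (t : R) : 0 < t ->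
  \forall L \near +oo, ln L <= L `^ t.
Proof.
move=> t0; near=> L.
have L0 : expR (4 / t ^+ 2) <= L by near: L; apply: nbhs_pinfty_ge; rewrite num_real.
have Lgt0 : 0 < L by rewrite (lt_le_trans _ L0)// expR_gt0.
have t20 : 0 < t ^+ 2 by rewrite exprn_gt0.
have lnL : 4 / t ^+ 2 <= ln L by rewrite -[leLHS]expRK ler_ln ?posrE ?expR_gt0.
have lnL0 : 0 <= ln L by apply: le_trans lnL; rewrite divr_ge0// ltW.
rewrite /powR gt_eqF//.
have -> : t * ln L = t * ln L / 2 + t * ln L / 2 by lra.
rewrite expRD; have h := expR_ge1Dx (t * ln L / 2).
have tl : 0 <= t * ln L / 2 by rewrite divr_ge0// mulr_ge0// ltW.
apply: (@le_trans _ _ ((t * ln L / 2) * (t * ln L / 2))); last by apply: ler_pM => //; lra.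
have -> : t * ln L / 2 * (t * ln L / 2) = ln L * (ln L * t ^+ 2 / 4) by field.
by rewrite ler_peMr// ler_pdivlMr// mul1r -ler_pdivrMr.
Unshelve. all: end_near. Qed.

Lemma scale_bounds (R : realType) (L t : R) : expR 1 <= L -> t <= 1 -> ln L <= L `^ t ->
  [/\ 0 < ln L / L `^ t, ln L / L `^ t <= 1 & L^-1 <= ln L / L `^ t].
Proof.
move=> Le t1 lnL.
have L0 : 0 < L by rewrite (lt_le_trans _ Le)// expR_gt0.
have L1 : 1 <= L by apply: le_trans Le; rewrite -[leLHS]expR0 ler_expR.
have lnL1 : 1 <= ln L by rewrite -[leLHS]expRK ler_ln ?posrE ?expR_gt0.
have Lt0 : 0 < L `^ t by rewrite powR_gt0.
split.
- by rewrite divr_gt0// (lt_le_trans ltr01).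
- by rewrite ler_pdivrMr// mul1r.
- rewrite -[leLHS]mul1r ler_pM ?invr_ge0 ?(ltW L0)// lef_pV2 ?posrE//.
  by rewrite -[leRHS]powRr1 ?(ltW L0)// ler_powR.
Qed.

Lemma level_bounds (R : realType) (L q : R) : 0 < q -> expR 1 <= L -> 4 <= L ->
  expR q^-1 <= L -> (q + 4) * ln L <= 2^-1 * L ->
  [/\ 0 < L `^ (- q), L `^ (- q) <= 2^-1, L `^ (- q) <= L `^ (q + 4),
      1 <= L `^ (q + 4) & L `^ (q + 4) * expR (- L) < 2^-1].
Proof.
move=> q0 Le L4 Lq hL.
have L0 : 0 < L by rewrite (lt_le_trans _ Le)// expR_gt0.
have lnL1 : 1 <= ln L by rewrite -[leLHS]expRK ler_ln ?posrE ?expR_gt0.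
have powE e : L `^ e = expR (e * ln L) by rewrite /powR gt_eqF.
have ql : 0 <= q * ln L by rewrite mulr_ge0// ?(ltW q0)// (le_trans ler01).
split.
- by rewrite powR_gt0.
- rewrite powE mulNr expRN lef_pV2 ?posrE ?expR_gt0//.
  have : 1 <= q * ln L.
    by rewrite mulrC -ler_pdivrMr// mul1r -[leLHS]expRK ler_ln ?posrE ?expR_gt0.
  by move: (expR_ge1Dx (q * ln L)); clear; lra.
- by rewrite !powE ler_expR; move: ql lnL1; clear; lra.
- by rewrite powE -[leLHS]expR0 ler_expR; move: ql lnL1; clear; lra.
- rewrite powE -expRD; apply: (@le_lt_trans _ _ (expR (- 2))).
    by rewrite ler_expR; move: hL L4; clear; lra.
  rewrite expRN; apply: (@le_lt_trans _ _ 3^-1); last by clear; lra.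
  rewrite lef_pV2 ?posrE ?expR_gt0//.
  by move: (expR_ge1Dx (2 : R)); clear; lra.
Qed.

(** Spacing at least [1/L] over a range of length O(L) needs O(L^2) points. *)
Lemma grid_size (R : realType) (K L r : R) : 0 < K -> 1 <= L -> 0 < r -> L^-1 <= r ->
  exists M, K * L <= M%:R * r /\ (2 * M).+1%:R <= (2 * K + 3) * L ^+ 2.
Proof.
move=> K0 L1 r0 rL; have L0 : 0 < L by rewrite (lt_le_trans ltr01).
have KLr : 0 <= K * L / r by rewrite divr_ge0 ?mulr_ge0// ltW.
exists (Num.truncn (K * L / r)).+1; split.
  by rewrite -ler_pdivrMr// ltW// truncnS_gt.
have h1 : (Num.truncn (K * L / r))%:R <= K * L / r by rewrite truncn_le.
have h2 : K * L / r <= K * L ^+ 2.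
  rewrite expr2 mulrA ler_wpM2l ?mulr_ge0 ?(ltW K0) ?(ltW L0)//.
  by rewrite -[leRHS]invrK lef_pV2 ?posrE ?invr_gt0.
have h3 : 1 <= L ^+ 2 by rewrite exprn_ege1.
by rewrite -natr1 natrM -natr1; move: h1 h2 h3; clear; lra.
Qed.

(* [f], [fm], [fp] are the values of the distribution function at a grid point
   and at the points at distance [r] before and after it. *)
Lemma deviation_bounds (R : realType) (n : nat) (c r L q m f fm fp : R) :
  0 < c -> 1 <= L -> L^-1 <= r -> 2 / c <= L -> 0 < q -> 0 < m ->
  L `^ (q + 4) <= n%:R * m -> 0 <= f <= 1 -> m = Num.min f (1 - f) ->
  fm <= 1 -> 0 <= fp -> c * r * m <= f - fm -> c * r * m <= fp - f ->
  [/\ 0 < n%:R * c * r * m / 2,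
     n.+1%:R * fm <= n%:R * f - n%:R * c * r * m / 2,
     n%:R * f + n%:R * c * r * m / 2 <= n.+1%:R * fp &
     n%:R * (f * (1 - f)) / (n%:R * c * r * m / 2) ^+ 2 <= 4 / c ^+ 2 * L `^ (- (q + 2))].
Proof.
move=> c0 L1 rL Lc q0 m0 nm /andP[f0 f1] mE fm1 fp0 h1 h2.
have L0 : 0 < L by rewrite (lt_le_trans ltr01).
have r0 : 0 < r by rewrite (lt_le_trans _ rL)// invr_gt0.
have nR : 0 <= n%:R :> R by [].
have powE e : L `^ e = expR (e * ln L) by rewrite /powR gt_eqF.
have LA : L ^+ 2 <= n%:R * m.
  apply: le_trans nm; rewrite -powR_mulrn ?(ltW L0)// ler_powR//.
  by move: q0; clear; lra.
have nm0 : 0 < n%:R * m by rewrite (lt_le_trans _ LA)// exprn_gt0.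
(* Half of the guaranteed increment; the other half, at least 1 by [s1], absorbs the passage from
   [n] to [n + 1]. *)
set s := n%:R * c * r * m / 2.
have s1 : 1 <= s.
  have hL : L <= r * (n%:R * m).
    have -> : L = L^-1 * L ^+ 2 by rewrite expr2 mulKf// gt_eqF.
    by apply: ler_pM => //; rewrite ?invr_ge0 ?exprn_ge0// ltW.
  have := ler_wpM2l (ltW c0) hL; rewrite ler_pdivrMr// in Lc.
  by rewrite /s; move: Lc; clear; lra.
have nh1 := ler_wpM2l nR h1; have nh2 := ler_wpM2l nR h2.
have sE : n%:R * (c * r * m) = 2 * s by rewrite /s; field.
rewrite sE in nh1 nh2; clearbody s.
split.
- by rewrite (lt_le_trans ltr01).
- by rewrite -natr1 mulrDl mul1r; move: s1 nh1 fm1; clear; lra.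
- by rewrite -natr1 mulrDl mul1r; move: s1 nh2 fp0; clear; lra.
have s0 : 0 < s by rewrite (lt_le_trans ltr01).
rewrite ler_pdivrMr ?exprn_gt0//.
have ff : f * (1 - f) <= m.
  by rewrite mE le_min ler_piMr ?ler_piMl ?subr_ge0 ?gerBl.
apply: (@le_trans _ _ (n%:R * m)); first by rewrite ler_wpM2l.
(* It remains that [r^2 * (n m) >= L^(-2) * L^(q+4) = L^(q+2)]. *)
have -> : 4 / c ^+ 2 * L `^ (- (q + 2)) * s ^+ 2 =
   (L `^ (- (q + 2)) * (r ^+ 2 * (n%:R * m))) * (n%:R * m).
  have -> : s = n%:R * (c * r * m) / 2 by rewrite sE mulrC mulKf.
  by field; rewrite gt_eqF.
rewrite ler_peMl//; first exact: ltW.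
have oneE : L `^ (- (q + 2)) * (L^-1 ^+ 2 * L `^ (q + 4)) = 1.
  have -> : L^-1 ^+ 2 = L `^ (- 2%:R) by rewrite powR_invn ?(ltW L0)// exprVn.
  by rewrite !powE -!expRD -[RHS]expR0; congr expR; clear; lra.
rewrite -[leLHS]oneE ler_wpM2l ?powR_ge0//; apply: ler_pM => //.
- by rewrite exprn_ge0// invr_ge0 ltW.
- exact: powR_ge0.
- by rewrite ler_pXn2r// nnegrE ?invr_ge0 ltW.
Qed.

Theorem theorem4 (R : realType) (p q : R)
    (mu : probability (measurableTypeR R) R)
    (p_gt1 : 1 < p) (q_gt0 : 0 < q)
    (mu_plc : p_log_concave p mu)
    (F_cont : continuous (cdf_of mu))
    (F_incr : forall x y : R, x < y -> cdf_of mu x < cdf_of mu y) :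
  exists (c : R) (n0 : nat), 0 < c /\
    forall n : nat, (n0 < n)%N ->
    forall (d : measure_display) (T : measurableType d) (P : probability T R)
           (X : 'I_n -> {RV P >-> R}),
    iid_sample mu X ->
    ((1 - c * ln n%:R `^ (- q))%:E <=
     P [set w : T |
          (sup (range (fun i : 'I_n =>
             `|order_stat (fun j => X j w) i
               - inverse_fun (cdf_of mu) (i.+1%:R / n.+1%:R)|))
           <= c * (ln (ln n%:R) / ln n%:R `^ (1 - p^-1)))%R])%E.
Proof.
have [a [g [a0 g0 cg muE]]] := mu_plc.
have [c [c0 Hc]] := cdf_of_increment_min p a g mu p_gt1 a0 g0 cg muE.
have [K' [K'0 HK']] := cdf_of_quantile_bound p a g mu p_gt1 a0 g0 cg muE.
have q4 : 0 <= q + 4 by rewrite addr_ge0// ltW.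
have [K [K0 HK]] := cdf_of_quantile_gap p a g mu p_gt1 a0 g0 cg muE (q + 4) q q4 (ltW q_gt0).
have Hq u : 0 < u -> u < 1 -> exists x, cdf_of mu x = u.
  exact: (cdf_of_quantile_exists p a g mu p_gt1 a0 g0 cg muE u F_cont).
have {a0 g0 cg muE mu_plc a g} p0 : 0 < p by exact: lt_trans p_gt1.
have [th thE] : exists t, t = 1 - p^-1 by eexists.
rewrite -thE in HK *.
have th0 : 0 < th by rewrite thE subr_gt0 invf_lt1.
have th1 : th <= 1 by rewrite thE gerBl invr_ge0 ltW.
(* The grid-point count and the failure probability per point, each without its power of [L]. *)
have [Kp KpE] : exists t, t = (2 * K' + 3) * (4 / c ^+ 2) by eexists.
have Kp0 : 0 < Kp.
  by rewrite KpE mulr_gt0 ?divr_gt0 ?exprn_gt0// addr_gt0// mulr_gt0.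
have key : \forall L \near +oo, [/\ expR 1 <= L, 4 <= L, expR q^-1 <= L, 2 / c <= L &
    ln L <= L `^ th /\ (q + 4) * ln L <= 2^-1 * L].
  near=> L; split; last split; near: L; try by apply: nbhs_pinfty_ge; rewrite num_real.
  - exact: near_pinfty_ln_le_powR.
  - by apply: near_pinfty_ln_le; rewrite invr_gt0.
have [L0 [_ HL0]] := filterI HK key.
(* [2 * K + 2] is [2 * D + 2 * r] for [D = K * r]; [Kp] pays for the grid, and 2 for the two
   extremes, each of probability at most [n * em = L^(-q)]. *)
exists ((2 * K + 2) + (Kp + 2)), (Num.truncn (expR L0)).+1; split.
  by move: K0 Kp0; clear; lra.
move=> n n_gt d T P X iid.
have n0 : (0 < n)%N by apply: leq_trans n_gt.
have nR0 : 0 < n%:R :> R by rewrite ltr0n.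
have nL0 : L0 < ln n%:R.
  rewrite -[ltLHS]expRK ltr_ln ?posrE ?expR_gt0//.
  by apply: lt_trans (truncnS_gt _) _; rewrite ltr_nat.
have [{key}HK [Le L4 Lq Lc [lnLth lnL2]]] := HL0 _ nL0.
have nE : n%:R^-1 = expR (- ln n%:R) :> R by rewrite expRN lnK// posrE ltr0n.
set L := ln n%:R in HK Le L4 Lq Lc lnLth lnL2 nE *; clearbody L.
have L1 : 1 <= L by apply: le_trans L4; rewrite ler1n.
have Lp : 0 < L by rewrite (lt_le_trans ltr01).
have [r0 r1 rL] := scale_bounds R L th Le th1 lnLth.
have [Lq0 Lq2 Lqq Lq1 ep2] := level_bounds R L q q_gt0 Le L4 Lq lnL2.
have [r rE] : exists t, t = ln L / L `^ th by eexists.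
rewrite -rE in HK r0 r1 rL *.
have [em emE] : exists t, t = L `^ (- q) * expR (- L) by eexists.
have [ep epE] : exists t, t = L `^ (q + 4) * expR (- L) by eexists.
rewrite -emE -epE in HK; rewrite -epE in ep2.
have em0 : 0 < em by rewrite emE mulr_gt0 ?expR_gt0.
have emp : em <= ep by rewrite emE epE ler_wpM2r ?expR_ge0.
have epL : expR (- L) <= ep by rewrite epE ler_peMl ?expR_ge0.
have nS0 : 0 < n.+1%:R :> R by rewrite ltr0n.
(* This places every level [i / (n + 1)] with [1 <= i <= n] between [em] and [1 - em]; it follows
   from [L^(-q) <= 1/2] and [n + 1 <= 2 n]. *)
have em_n : em <= n.+1%:R^-1.
  apply: (@le_trans _ _ (2^-1 * expR (- L))); first by rewrite emE ler_wpM2r ?expR_ge0.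
  rewrite -nE -invfM lef_pV2 ?posrE ?mulr_gt0//.
  by rewrite -natrM ler_nat mul2n -addnn -addn1 leq_add2l.
have [[ep0 ep1] [ep0' ep1'] [em1 [em0' em1']]] : [/\ 0 < ep /\ ep < 1,
    0 < 1 - ep /\ 1 - ep < 1 & em < 1 /\ 0 < 1 - em /\ 1 - em < 1].
  by clear -em0 emp ep2; split; [split|split|split; [|split]]; lra.
have [ym Fym] := Hq em em0 em1; have [yp Fyp] := Hq ep ep0 ep1.
have [zp Fzp] := Hq (1 - ep) ep0' ep1'; have [zm Fzm] := Hq (1 - em) em0' em1'.
have Fle x y : cdf_of mu x <= cdf_of mu y -> x <= y.
  by move=> h; rewrite leNgt; apply/negP => /F_incr; rewrite ltNge h.
have gap1 : yp - ym <= K * r.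
  have ymp : ym <= yp by apply: Fle; rewrite Fym Fyp.
  by have [+ _] := HK ym yp ymp; apply; rewrite ?Fym ?Fyp.
have gap2 : zm - zp <= K * r.
  have zpm : zp <= zm by apply: Fle; rewrite Fzp Fzm lerD2l lerN2.
  by have [_] := HK zp zm zpm; apply; rewrite ?Fzp ?Fzm subKr.
have [M [MK ML]] := grid_size R K' L r K'0 L1 r0 rL.
have epS : expR (- L) <= 1 - ep by clear -epL ep2; lra.
have ypM : - (M%:R * r) <= yp.
  have := HK' L yp L1; rewrite Fyp => /(_ epL epS)/le_trans/(_ MK).
  by rewrite ler_norml => /andP[].
have zpM : zp <= M%:R * r.
  have := HK' L zp L1; rewrite Fzp subKr => /(_ epS epL)/le_trans/(_ MK).
  by rewrite ler_norml => /andP[].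
pose m y := Num.min (cdf_of mu y) (1 - cdf_of mu y).
have [e eE] : exists t, t = 4 / c ^+ 2 * L `^ (- (q + 2)) by eexists.
have e0 : 0 <= e by rewrite eE mulr_ge0 ?powR_ge0 ?divr_ge0 ?exprn_ge0// ltW.
have nep : n%:R * ep = L `^ (q + 4) by rewrite epE mulrCA -nE divff ?mulr1// gt_eqF.
have nem : n%:R * em = L `^ (- q) by rewrite emE mulrCA -nE divff ?mulr1// gt_eqF.
have Hs y : yp <= y <= zp -> [/\ 0 < n%:R * c * r * m y / 2,
     n.+1%:R * cdf_of mu (y - r) <= n%:R * cdf_of mu y - n%:R * c * r * m y / 2,
     n%:R * cdf_of mu y + n%:R * c * r * m y / 2 <= n.+1%:R * cdf_of mu (y + r) &
     n%:R * (cdf_of mu y * (1 - cdf_of mu y)) / (n%:R * c * r * m y / 2) ^+ 2 <= e].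
  move=> /andP[/(cdf_of_homo mu) Fy1 /(cdf_of_homo mu) Fy2].
  rewrite Fyp in Fy1; rewrite Fzp in Fy2.
  have mep : ep <= m y by rewrite le_min Fy1/= lerBrDl -lerBrDr.
  have rr : 0 <= r <= 1 by rewrite (ltW r0).
  have [h1 _] := Hc y r rr; have [_ h2] := Hc (y - r) r rr; rewrite subrK in h2.
  rewrite eE; apply: deviation_bounds => //.
  - exact: lt_le_trans mep.
  - by rewrite -nep ler_wpM2l// ltW.
  - by rewrite cdf_of_ge0 cdf_of_le1.
  - exact: cdf_of_le1.
  - exact: cdf_of_ge0.
have Hv (i : 'I_n) : let v := inverse_fun (cdf_of mu) (i.+1%:R / n.+1%:R) in
    ym <= v <= zm /\ cdf_of mu v = i.+1%:R / n.+1%:R.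
  have i1 : 1 <= i.+1%:R :> R by rewrite ler1n.
  have u1 : em <= i.+1%:R / n.+1%:R.
    by apply: le_trans em_n _; rewrite ler_peMl// invr_ge0 ltW.
  have u2 : i.+1%:R / n.+1%:R <= 1 - em.
    rewrite lerBrDr -lerBrDl; apply: le_trans em_n _.
    have -> : 1 - i.+1%:R / n.+1%:R = (n.+1%:R - i.+1%:R) / n.+1%:R :> R.
      by rewrite mulrBl divff// gt_eqF.
    rewrite ler_peMl ?invr_ge0 ?(ltW nS0)// -natrB; last by rewrite ltnS ltnW.
    by rewrite ler1n subn_gt0 ltnS.
  have Fv := inverse_funK _ _ _ (Hq _ (lt_le_trans em0 u1) (le_lt_trans u2 em1')).
  by split => //; apply/andP; split; apply: Fle; rewrite Fv ?Fym ?Fzm.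
have KL := mulr_ge0 (ltW K0) (ltW Lq0).
have Kr := mulr_ge0 (ltW Kp0) (ltW r0).
apply: le_trans (order_stat_concentration mu d T P n X iid M r (K * r) ym yp zp zm
  ((2 * K + 2 + (Kp + 2)) * r) e _ _ n0 r0 _ gap1 gap2 ypM zpM _ e0 Hs Hv); last 2 first.
- by rewrite mulr_ge0// ltW.
- by clear -Kr r0; lra.
rewrite Fym Fzm subKr lee_fin lerD2l lerN2 nem.
have : (2 * M).+1%:R * e <= Kp * L `^ (- q).
  apply: le_trans (ler_wpM2r e0 ML) _.
  have -> : L `^ (- q) = L ^+ 2 * L `^ (- (q + 2)).
    rewrite -powR_mulrn ?(ltW Lp)// -powRD; last by rewrite (gt_eqF Lp) implybT.
    by congr (_ `^ _); clear; lra.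
  by rewrite eE KpE; clear; lra.
by clear -KL Lq0; lra.
Unshelve. all: end_near. Qed.
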